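(* For every positive integer $n$, the Boolean lattice $\mathcal{B}_n$ of order $n$ satisfies $$\operatorname{ldim}(\mathcal{B}_n)\leq \left\lceil \frac{5}{7}\,n\right\rceil.$$
   Context: A poset is a pair $P=(X,\leq)$ where $X$ is a non-empty set and $\leq$ is a reflexive, antisymmetric, transitive relation on $X$. A poset $Q$ is a subposet of $P$ if the ground set of $Q$ is a subset of that of $P$ and the order of $Q$ is the restriction of the order of $P$. A linear extension of $P$ is a linear order $L$ on the ground set of $P$ such that $x\leq_L y$ whenever $x\leq_P y$. A partial linear extension of $P$ is a linear extension of a subposet of $P$. A local realizer of $P$ is a family $\mathcal{L}$ of partial linear extensions of $P$ such that for all $x,y\in P$ there exists $L\in\mathcal{L}$ with $x,y\in L$, and $x\leq_P y$ if and only if there is no $L\in\mathcal{L}$ with $y<_L x$. The frequency of an element $x\in P$ in $\mathcal{L}$ is the number of $L\in\mathcal{L}$ with $x\in L$ (i.e. $x$ is in the ground set of $L$); the frequency of $\mathcal{L}$ is the maximum frequency of an element of $P$ in $\mathcal{L}$. The local dimension $\operatorname{ldim}(P)$ is the minimum frequency of a local realizer of $P$. For a positive integer $n$, the Boolean lattice $\mathcal{B}_n$ is the poset of all subsets of $[n]=\{1,\dots,n\}$ ordered by inclusion. *)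

(* Defs.v *)
From mathcomp Require Import all_boot all_order.
From mathcomp Require Import boolp.

Set Implicit Arguments.
Unset Strict Implicit.
Unset Printing Implicit Defensive.

Import Order.TTheory.
Local Open Scope order_scope.

Section LocalDimension.
Variables (d : Order.disp_t) (P : finPOrderType d).

(* A linear extension of the subposet of P on the non-empty set [ground].
   The values of [ple_le] outside [ground] carry no information.
   Reflexivity on [ground] is the case x = y of [ple_total]. *)
Record partialLinearExtension := PartialLinearExtension {
  ground : {set P};
  ple_le : rel P;
  ground_neq0 : ground != set0;
  ple_anti : {in ground &, antisymmetric ple_le};
  ple_trans : {in ground & &, transitive ple_le};
  ple_total : {in ground &, total ple_le};
  ple_ext : {in ground &, forall x y, x <= y -> ple_le x y}
}.

Definition ple_lt (L : partialLinearExtension) : rel P :=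
  fun x y => [&& x \in ground L, y \in ground L, x != y & ple_le L x y].

(* Families are indexed by finite types. This loses nothing: P is finite, so a
   family in which every element has finite frequency has finitely many
   members, their ground sets being non-empty. *)
Definition local_realizer (I : finType) (F : I -> partialLinearExtension) :=
  forall x y : P,
    (exists i, x \in ground (F i) /\ y \in ground (F i)) /\
    (x <= y <-> ~ exists i, ple_lt (F i) y x).

Definition elt_frequency (I : finType) (F : I -> partialLinearExtension)
    (x : P) : nat :=
  #|[set i | x \in ground (F i)]|.

Definition frequency (I : finType) (F : I -> partialLinearExtension) : nat :=
  \max_(x : P) elt_frequency F x.

Definition has_local_realizer (k : nat) : Prop :=
  exists (I : finType) (F : I -> partialLinearExtension),
    local_realizer F /\ frequency F = k.

Section PairExtension.
Variable p : P * P.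
Hypothesis p_ok : ~~ (p.2 < p.1).

Let pair_le : rel P := fun a b => (a == b) || ((a == p.1) && (b == p.2)).

Fact pair_neq0 : [set p.1; p.2] != set0.
Proof. by apply/set0Pn; exists p.1; rewrite set21. Qed.

Fact pair_anti : {in [set p.1; p.2] &, antisymmetric pair_le}.
Proof.
move=> a b _ _ /andP[/orP[/eqP//|/andP[/eqP-> /eqP->]]].
by case/orP=> [/eqP//|/andP[/eqP-> /eqP]].
Qed.

Fact pair_trans : {in [set p.1; p.2] & &, transitive pair_le}.
Proof.
move=> b a c _ _ _ /orP[/eqP->//|/andP[/eqP-> /eqP->]].
case/orP=> [/eqP<-|/andP[_ /eqP->]]; by rewrite /pair_le !eqxx orbT.
Qed.

Fact pair_total : {in [set p.1; p.2] &, total pair_le}.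
Proof.
by move=> a b /set2P[]-> /set2P[]->; rewrite /pair_le !eqxx ?orbT.
Qed.

Fact pair_ext : {in [set p.1; p.2] &, forall x y, x <= y -> pair_le x y}.
Proof.
move=> a b /set2P[]-> /set2P[]->; rewrite /pair_le ?eqxx ?orbT // => le21.
by move: p_ok; rewrite lt_neqAle le21 andbT negbK => /eqP->; rewrite eqxx.
Qed.

Definition pair_ple : partialLinearExtension :=
  PartialLinearExtension pair_neq0 pair_anti pair_trans pair_total pair_ext.

End PairExtension.

(* The two-element chains consistent with P form a local realizer, so the
   minimum defining [ldim] is over a non-empty set. *)
Fact has_local_realizer_ex : exists k, `[< has_local_realizer k >].
Proof.
pose I : finType := {p : P * P | ~~ (p.2 < p.1)}.
pose F (i : I) := pair_ple (valP i).
exists (frequency F); apply/asboolP; exists I, F; split=> // x y; split.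
  case: (boolP (y < x)) => yx.
    have h : ~~ ((y, x).2 < (y, x).1) by rewrite /= lt_gtF.
    by exists (Sub (y, x) h); rewrite /= set21 set22.
  have h : ~~ ((x, y).2 < (x, y).1) by [].
  by exists (Sub (x, y) h); rewrite /= set21 set22.
split=> [xy [[[a b] h]] /and4P[_ _ /negPf yx]|no].
  rewrite /= yx /= => /andP[/eqP ya /eqP xb].
  by move: h; rewrite /= -ya -xb lt_neqAle xy andbT eq_sym yx.
apply/negPn/negP => nxy; apply: no.
have h : ~~ ((y, x).2 < (y, x).1).
  by apply/negP => /ltW xy; rewrite xy in nxy.
exists (Sub (y, x) h); rewrite /ple_lt /= set21 set22 !eqxx orbT andbT /=.
by apply: contraNneq nxy => ->.
Qed.

Definition ldim : nat := ex_minn has_local_realizer_ex.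

End LocalDimension.

(* Subsets of {0, ..., n-1}, standing for {1, ..., n}; the canonical order on
   [{set _}] imported here is inclusion. *)
Import Order.DefaultSetSubsetOrder.

Definition booleanLattice (n : nat) : finPOrderType _ := {set 'I_n}.

(* Main.v *)
Require Import Defs.
From mathcomp Require Import all_boot all_order all_algebra.
From mathcomp Require Import boolp zify lra.
Import Order.TTheory GRing.Theory Num.Theory.

Set Implicit Arguments.
Unset Strict Implicit.
Unset Printing Implicit Defensive.

(** Local dimension is subadditive over products: if every partial order of a
    local realizer of P is made into one of P x Q by breaking ties with a
    linear extension of Q, and symmetrically for Q, the two families together
    form a local realizer of P x Q whose frequencies add up
    ([realizing_product]). As the Boolean lattice of order n is the product of
    a power of the one of order 7 and one of order at most 7, it is enough to
    have local realizers of frequency 1, 3 and 5 for the orders 1, 4 and 7;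
    the other residues are sums of these, and each of them gives exactly
    ceil (5 n / 7).

    For n = 4 and n = 7 the realizers have n members, one for each element y of
    the ground set. The member of y compares sets lexicographically, looking at
    y first. Some lexicographic order must do so: every element distinguishes {y}
    from its complement, so {y} comes above only if y is looked at first. The
    remaining elements are looked at in an order that depends on whether the
    sets contain y, which reverses many pairs in more than one member. This
    leaves room to delete each set from one member (n = 4) or from two members
    (n = 7), so that the frequency falls to 3 and to 5. All members are
    rotations of one another, up to the choice of deleted sets, which is a
    finite table ([cyclic_rank]). That these families are local realizers is
    checked by evaluating a decision procedure ([realizingb]) on all pairs of
    words.

    Subsets of {0, ..., n-1} are handled as words of n bits, and a family of
    partial linear orders is given by ranks: a word has, in each member, either
    a natural number or, if it is deleted there, [None]. *)

(** * Words *)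

Definition subword (v w : bitseq) := all2 implb v w.

Lemma subword_cat v1 v2 w1 w2 : size v1 = size w1 ->
  subword (v1 ++ v2) (w1 ++ w2) = subword v1 w1 && subword v2 w2.
Proof. by elim: v1 w1 => [|b v1 IH] [|c w1] //= [/IH]; rewrite /subword => ->; rewrite andbA. Qed.

Definition value (w : bitseq) : nat := foldr (fun (b : bool) a => b + a.*2) 0 w.

Lemma value_lt w : value w < 2 ^ size w.
Proof. by elim: w => //= b w IH; rewrite expnS; case: b => /=; lia. Qed.

Lemma value_inj v w : size v = size w -> value v = value w -> v = w.
Proof.
elim: v w => [|b v IH] [|c w] //= [sz] h.
have bc : b = c by case: b c h => -[] //=; lia.
by rewrite bc (IH w sz) //; move: h; rewrite bc; lia.
Qed.

Lemma value_subword v w : subword v w -> value v <= value w.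
Proof.
elim: v w => [|b v IH] [|c w] //= /andP[bc /IH]; case: b c bc => -[] //=; lia.
Qed.

(** * Local realizers given by ranks *)

Definition rank (R : bitseq -> seq (option nat)) i w := nth None (R w) i.

(** The ranks [R] describe a local realizer of the words of length [n] with [m]
    members and frequency at most [k]. For [v] not below [w], [rank_sep] asks
    for a member with [w] strictly under [v]; for [v] below [w] it only asks
    for a member containing both. *)
Record realizing (n m k : nat) (R : bitseq -> seq (option nat)) : Prop := {
  rank_size w : size w = n -> size (R w) = m;
  rank_inhab i : i < m -> exists2 w, size w = n & rank R i w;
  rank_inj i v w a : size v = n -> size w = n ->
    rank R i v = Some a -> rank R i w = Some a -> v = w;
  rank_ext i v w a b : size v = n -> size w = n -> subword v w ->
    rank R i v = Some a -> rank R i w = Some b -> a <= b;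
  rank_sep v w : size v = n -> size w = n -> exists i a b,
    [/\ rank R i v = Some a, rank R i w = Some b & subword v w || (b < a)];
  rank_freq w : size w = n -> count isSome (R w) <= k
}.

(** * Subadditivity *)

(** Ties in the rank are broken by the word [t] read as a binary number: this is
    the lexicographic order, since the value of [t] is below [2 ^ size t]. *)
Definition extend (t : bitseq) : option nat -> option nat :=
  omap (fun a => a * 2 ^ size t + value t).

Lemma extend_inj t t' o o' c : size t = size t' ->
  extend t o = Some c -> extend t' o' = Some c -> t = t' /\ o = o'.
Proof.
case: o o' => [a|] [a'|] //= sz [<-] [].
have [lt lt'] := (value_lt t, value_lt t'); rewrite sz in lt * => e.
have ea : a' = a by nia.
by split; [apply: value_inj => //; nia | rewrite ea].
Qed.

Lemma extend_le t t' a a' c c' : size t = size t' -> subword t t' -> a <= a' ->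
  extend t (Some a) = Some c -> extend t' (Some a') = Some c' -> c <= c'.
Proof. by move=> sz /value_subword le lea [<-] [<-]; rewrite sz; nia. Qed.

Lemma extend_lt t t' a a' : size t = size t' -> a < a' ->
  a * 2 ^ size t + value t < a' * 2 ^ size t' + value t'.
Proof. by move=> sz; have := value_lt t; rewrite sz; nia. Qed.

Lemma rank_extend (s : seq (option nat)) t i :
  nth None [seq extend t o | o <- s] i = extend t (nth None s i).
Proof.
have [lt|le] := ltnP i (size s); first by rewrite (nth_map None).
by rewrite !nth_default ?size_map.
Qed.

Definition product_ranks n1 R1 R2 (w : bitseq) : seq (option nat) :=
  let u := take n1 w in let t := drop n1 w in
  [seq extend t o | o <- R1 u] ++ [seq extend u o | o <- R2 t].

(** If [v] is not below [w], this already fails for the first or for the second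
    factors; a member of the realizer of that factor reverses them, and its
    extension reverses [v] and [w]. *)
Lemma realizing_product n1 n2 m1 m2 k1 k2 R1 R2 :
  realizing n1 m1 k1 R1 -> realizing n2 m2 k2 R2 ->
  realizing (n1 + n2) (m1 + m2) (k1 + k2) (product_ranks n1 R1 R2).
Proof.
move=> H1 H2.
have st (w : bitseq) : size w = n1 + n2 -> size (take n1 w) = n1.
  by move=> sz; rewrite size_takel // sz leq_addr.
have sd (w : bitseq) : size w = n1 + n2 -> size (drop n1 w) = n2.
  by move=> sz; rewrite size_drop sz addKn.
have subE v w : size v = n1 + n2 -> size w = n1 + n2 -> subword v w =
    subword (take n1 v) (take n1 w) && subword (drop n1 v) (drop n1 w).
  move=> sv sw; rewrite -{1}(cat_take_drop n1 v).
  by rewrite -{1}(cat_take_drop n1 w) subword_cat // !st.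
have rankE i w : size w = n1 + n2 -> rank (product_ranks n1 R1 R2) i w =
    if i < m1 then extend (drop n1 w) (rank R1 i (take n1 w))
    else extend (take n1 w) (rank R2 (i - m1) (drop n1 w)).
  move=> sw; rewrite /rank /product_ranks nth_cat size_map.
  by rewrite (rank_size H1) ?st // !rank_extend.
split.
- move=> w sw.
  by rewrite size_cat !size_map (rank_size H1) ?(rank_size H2) ?st ?sd.
- move=> i lti; have [lt|le] := ltnP i m1.
    have [u su ru] := rank_inhab H1 lt.
    have sw : size (u ++ nseq n2 false) = n1 + n2.
      by rewrite size_cat size_nseq su.
    exists (u ++ nseq n2 false) => //; rewrite rankE // lt.
    by rewrite -su take_size_cat //; case: (rank R1 i u) ru.
  have lt2 : i - m1 < m2 by rewrite ltn_subLR.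
  have [t tsz rt] := rank_inhab H2 lt2.
  have sw : size (nseq n1 false ++ t) = n1 + n2.
    by rewrite size_cat size_nseq tsz.
  exists (nseq n1 false ++ t) => //; rewrite rankE // ltnNge le /=.
  by rewrite drop_size_cat ?size_nseq //; case: (rank R2 _ t) rt.
- move=> i v w a sv sw; rewrite !rankE //.
  have eq_vw : take n1 v = take n1 w -> drop n1 v = drop n1 w -> v = w.
    by move=> e e'; rewrite -(cat_take_drop n1 v) e e' cat_take_drop.
  case: ifP => _ hv hw.
    have [|e eo] := extend_inj _ hv hw; first by rewrite !sd.
    apply: eq_vw => //; case E: (rank R1 i (take n1 v)) hv => [c|] // _.
    by apply: (rank_inj H1) (E) _; rewrite ?st // -eo E.
  have [|e eo] := extend_inj _ hv hw; first by rewrite !st.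
  apply: eq_vw => //; case E: (rank R2 _ (drop n1 v)) hv => [c|] // _.
  by apply: (rank_inj H2) (E) _; rewrite ?sd // -eo E.
- move=> i v w a b sv sw; rewrite subE // !rankE // => /andP[s1 s2].
  case: ifP => _ hv hw.
    case Ev: (rank R1 i _) hv => [c|] // hv.
    case Ew: (rank R1 i _) hw => [c'|] // hw.
    apply: extend_le hv hw => //; first by rewrite !sd.
    by apply: (rank_ext H1) Ev Ew => //; rewrite st.
  case Ev: (rank R2 _ _) hv => [c|] // hv.
  case Ew: (rank R2 _ _) hw => [c'|] // hw.
  apply: extend_le hv hw => //; first by rewrite !st.
  by apply: (rank_ext H2) Ev Ew => //; rewrite sd.
- move=> v w sv sw; rewrite subE //.
  (* A word has a rank only in the members of the family. *)
  have ltm i u c : size u = n1 -> rank R1 i u = Some c -> i < m1.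
    move=> su; rewrite ltnNge; apply: contra_eqN => le.
    by rewrite /rank nth_default ?(rank_size H1).
  have [i [a [b [ra rb h1]]]] := rank_sep H1 (st v sv) (st w sw).
  have [j [c [d [rc rd h2]]]] := rank_sep H2 (sd v sv) (sd w sw).
  case/orP: h1 => [s1|lt1]; last first.
    exists i; do 2!eexists; rewrite !rankE // (ltm _ _ _ _ ra) ?st // ra rb.
    by split=> //; rewrite extend_lt ?orbT // !sd.
  exists (m1 + j); do 2!eexists; rewrite !rankE // ltnNge leq_addr /= addKn.
  rewrite rc rd; split=> //; rewrite s1 /=.
  by case/orP: h2 => [->//|lt2]; rewrite extend_lt ?orbT // !st.
- move=> w sw; rewrite count_cat !count_map.
  have cE t s : count (preim (extend t) isSome) s = count isSome s.
    by apply: eq_count => -[].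
  by rewrite !cE leq_add ?(rank_freq H1) ?(rank_freq H2) ?st ?sd.
Qed.

(** * From ranks to local dimension *)

Lemma le_booleanLattice n (A B : booleanLattice n) :
  (A <= B)%O = (A \subset B).
Proof. by []. Qed.

Section FromRanks.
Variables (n m k : nat) (R : bitseq -> seq (option nat)).
Hypothesis HR : realizing n m k R.

Definition word (A : {set 'I_n}) : bitseq := [seq i \in A | i <- enum 'I_n].

Lemma size_word A : size (word A) = n.
Proof. by rewrite size_map size_enum_ord. Qed.

Lemma nth_word A (i : 'I_n) : nth false (word A) i = (i \in A).
Proof. by rewrite (nth_map i) ?size_enum_ord ?nth_ord_enum. Qed.

Lemma word_inj : injective word.
Proof. by move=> A B e; apply/setP => i; rewrite -!nth_word e. Qed.

Lemma word_surj w : size w = n -> exists A, word A = w.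
Proof.
move=> sw; exists [set i : 'I_n | nth false w i].
apply: (@eq_from_nth _ false); rewrite size_word // => i lti.
by rewrite (nth_word _ (Ordinal lti)) inE.
Qed.

Lemma subword_word A B : subword (word A) (word B) = (A \subset B).
Proof.
rewrite /subword /word; apply/idP/subsetP => [h i iA|sAB].
  have := mem_enum 'I_n i; rewrite inE; move: h.
  elim: (enum 'I_n) => //= j s IH /andP[hj /IH{}IH].
  by rewrite inE => /orP[/eqP ei|/IH//]; move: hj; rewrite -ei iA.
by elim: (enum 'I_n) => //= j s ->; rewrite andbT; apply/implyP/sAB.
Qed.

Section OneRank.
Variable i : 'I_m.

Let P : finPOrderType _ := booleanLattice n.
Definition rank_ground : {set P} := [set A : P | rank R i (word A)].
Definition rank_le : rel P :=
  fun A B => odflt 0 (rank R i (word A)) <= odflt 0 (rank R i (word B)).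

Fact rank_ground_neq0 : rank_ground != set0.
Proof.
have [w sw rw] := rank_inhab HR (ltn_ord i).
have [A eA] := word_surj sw.
by apply/set0Pn; exists A; rewrite inE eA.
Qed.

Fact rank_le_anti : {in rank_ground &, antisymmetric rank_le}.
Proof.
move=> A B; rewrite !inE /rank_le.
case EA: (rank R i _) => [a|] //; case EB: (rank R i _) => [b|] //= _ _.
rewrite -eqn_leq => /eqP e; apply: word_inj.
by apply: (rank_inj HR) EA _; rewrite ?size_word // e.
Qed.

Fact rank_le_trans : {in rank_ground & &, transitive rank_le}.
Proof. by move=> B A C _ _ _; apply: leq_trans. Qed.

Fact rank_le_total : {in rank_ground &, total rank_le}.
Proof. by move=> A B _ _; apply: leq_total. Qed.

Fact rank_le_ext : {in rank_ground &, forall A B, (A <= B)%O -> rank_le A B}.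
Proof.
move=> A B; rewrite !inE /rank_le => hA hB; rewrite le_booleanLattice => sAB.
case EA: (rank R i _) hA => [a|] // _; case EB: (rank R i _) hB => [b|] //= _.
by apply: (rank_ext HR) EA EB; rewrite ?size_word ?subword_word.
Qed.

Definition rank_ple : partialLinearExtension P :=
  PartialLinearExtension rank_ground_neq0 rank_le_anti rank_le_trans
    rank_le_total rank_le_ext.

End OneRank.

Lemma rank_ord j A c : rank R j (word A) = Some c -> j < m.
Proof.
rewrite ltnNge; apply: contra_eqN => le.
by rewrite /rank nth_default ?(rank_size HR) ?size_word.
Qed.

Lemma rank_local_realizer : local_realizer rank_ple.
Proof.
move=> A B; split.
  have [j [a [b [ra rb _]]]] := rank_sep HR (size_word A) (size_word B).
  by exists (Ordinal (rank_ord ra)); rewrite /= !inE ra rb.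
split=> [leAB [i] | no].
  rewrite /ple_lt => /and4P[/= gB gA /negP neBA leBA]; apply: neBA.
  apply/eqP; apply: (rank_le_anti gB gA); rewrite leBA.
  exact: (rank_le_ext gA gB leAB).
have [j [a [b [ra rb]]]] := rank_sep HR (size_word A) (size_word B).
rewrite subword_word -le_booleanLattice => /orP[//|ltba]; case: no.
exists (Ordinal (rank_ord ra)); rewrite /ple_lt /= !inE /rank_le /= ra rb /=.
by rewrite (ltnW ltba) andbT; apply/eqP=> e; move: ra; rewrite -e rb => -[e']; lia.
Qed.

Lemma rank_frequency : frequency rank_ple <= k.
Proof.
apply/bigmax_leqP => A _; apply: leq_trans (rank_freq HR (size_word A)).
have -> : R (word A) = [seq rank R i (word A) | i : 'I_m <- enum 'I_m].
  apply: (@eq_from_nth _ None); rewrite (rank_size HR) ?size_word //.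
    by rewrite size_map size_enum_ord.
  by move=> i lti; rewrite (nth_map (Ordinal lti)) ?nth_enum_ord ?size_enum_ord.
rewrite count_map /elt_frequency cardE enumT /enum_mem size_filter.
by apply: sub_count => i; rewrite /= !inE.
Qed.

Lemma ldim_ranks : ldim (booleanLattice n) <= k.
Proof.
apply: leq_trans rank_frequency; rewrite /ldim; case: ex_minnP => l _; apply.
by apply/asboolP; exists 'I_m, rank_ple; split=> //; apply: rank_local_realizer.
Qed.

End FromRanks.

(** * A decision procedure for local realizers *)

Fixpoint words n : seq bitseq :=
  if n is n'.+1 then map (cons false) (words n') ++ map (cons true) (words n')
  else [:: [::]].

Lemma mem_words n w : (w \in words n) = (size w == n).
Proof.
elim: n w => [|n IH] [|b w] //=; rewrite mem_cat.
  by apply/norP; split; apply/mapP => -[].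
have consE c : (b :: w \in map (cons c) (words n)) = (b == c) && (size w == n).
  rewrite -IH; apply/mapP/andP => [[u uin [eb ew]]|[/eqP-> win]].
    by rewrite eb ew.
  by exists w.
by rewrite !consE eqSS; case: (b); rewrite ?orbF.
Qed.

Definition compatible (p q : bitseq * seq (option nat)) :=
  let z := zip p.2 q.2 in
  all (fun ab => if ab is (Some a, Some b)
       then ((a == b) ==> (p.1 == q.1)) && (subword p.1 q.1 ==> (a <= b))
       else true) z &&
  has (fun ab => if ab is (Some a, Some b) then subword p.1 q.1 || (b < a)
       else false) z.

(** The ranks of all words are tabulated once, so that evaluating the test on all
    pairs does not recompute them. *)
Definition realizingb n m k R :=
  let T := [seq (w, R w) | w <- words n] in
  [&& all (fun p => (size p.2 == m) && (count isSome p.2 <= k)) T,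
      all (fun i => has (fun p => isSome (nth None p.2 i)) T) (iota 0 m) &
      all (fun p => all (compatible p) T) T].

(** * The cyclic families *)

(** Little-endian: letter [i] of the word is bit [i] of [a]. *)
Definition numeral n a : bitseq := mkseq (fun i => odd (a %/ 2 ^ i)) n.

(** The rank of [w] in the member of [y]. Rotating [w] by [y] brings the letter
    [y] to the front; letters are then compared in the order [0 :: up] if that
    letter is set and [0 :: lo] if not, the first one being the most
    significant (hence [rev]). A pair [(d, l)] of the table lists words, up to
    rotation, that are deleted from two members at distance [d] (from a single
    one if [d = 0]): if [s] is the least shift that takes [w] into [l], then [w]
    is deleted from the members of [s] and [s + d]. Taking the least shift makes
    this meaningful for periodic words, which have several. *)
Definition cyclic_rank n (lo up : seq nat) (table : seq (nat * seq nat))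
    (y : nat) (w : bitseq) : option nat :=
  let omitted := has (fun dl =>
    let l := [seq numeral n a | a <- dl.2] in
    let s := find (fun s => rot s w \in l) (iota 0 n) in
    (s < n) && ((y == s) || (y == (s + dl.1) %% n))) table in
  if omitted then None else
  let v := rot y w in
  Some (value (rev [seq nth false v i | i <- 0 :: if head false v then up else lo])).

Definition cyclic_ranks n lo up table (w : bitseq) : seq (option nat) :=
  [seq cyclic_rank n lo up table y w | y <- iota 0 n].


Lemma realizingP n m k R : realizingb n m k R -> realizing n m k R.
Proof.
case/and3P => /allP hsize /allP hinhab /allP hcomp.
have inT w : size w = n -> (w, R w) \in [seq (w, R w) | w <- words n].
  by move=> sw; apply/map_f; rewrite mem_words sw.
have pair v w : size v = n -> size w = n -> compatible (v, R v) (w, R w).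
  by move=> sv sw; apply: (allP (hcomp _ (inT v sv))) (inT w sw).
have sizeR w : size w = n -> size (R w) = m.
  by move=> sw; have /andP[/eqP] := hsize _ (inT w sw).
have nthz v w i : size v = n -> size w = n -> i < m ->
    nth (None, None) (zip (R v) (R w)) i = (rank R i v, rank R i w).
  by move=> sv sw lti; rewrite nth_zip ?sizeR.
have sizez v w : size v = n -> size w = n -> size (zip (R v) (R w)) = m.
  by move=> sv sw; rewrite size_zip !sizeR ?minnn.
have common v w i a b : size v = n -> size w = n ->
    rank R i v = Some a -> rank R i w = Some b ->
    ((a == b) ==> (v == w)) && (subword v w ==> (a <= b)).
  move=> sv sw ra rb; have lti : i < m.
    rewrite ltnNge; apply: contra_eqN ra => le.
    by rewrite /rank nth_default ?sizeR.
  have /andP[/(all_nthP (None, None))/(_ i) + _] := pair v w sv sw.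
  by rewrite sizez // nthz // ra rb; apply.
split=> //.
- move=> i lti; have /hinhab/hasP[_ /mapP[w win ->] rw] : i \in iota 0 m.
    by rewrite mem_iota.
  by exists w => //; apply/eqP; rewrite -mem_words.
- move=> i v w a sv sw ra rb.
  by have /andP[] := common _ _ _ _ _ sv sw ra rb; rewrite eqxx => /eqP.
- move=> i v w a b sv sw svw ra rb.
  by have /andP[_] := common _ _ _ _ _ sv sw ra rb; rewrite svw.
- move=> v w sv sw.
  have /andP[_ /(has_nthP (None, None))[i]] := pair v w sv sw.
  rewrite sizez // => lti; rewrite nthz //.
  case ra: (rank R i v) => [a|] //; case rb: (rank R i w) => [b|] // h.
  by exists i, a, b.
- by move=> w sw; have /andP[] := hsize _ (inT w sw).
Qed.

(** The whole chain of two elements, with nothing deleted. *)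
Lemma realizing_1 : exists m R, realizing 1 m 1 R.
Proof.
exists 1, (cyclic_ranks 1 [::] [::] [::]).
by apply: realizingP; vm_compute.
Qed.

(** The table has one word of each rotation class, so each set is deleted from
    exactly one of the four members. The table and the two
    orders of the letters come from a computer search. *)
Lemma realizing_4 : exists m R, realizing 4 m 3 R.
Proof.
exists 4, (cyclic_ranks 4 [:: 3; 2; 1] [:: 2; 1; 3]
  [:: (0, [:: 0; 4; 5; 12; 13; 15])]).
by apply: realizingP; vm_compute.
Qed.

(** The three lists together have one word of each rotation class, so each set is
    deleted from exactly two of the seven members. The lists and the two
    orders of the letters come from a computer search. *)
Lemma realizing_7 : exists m R, realizing 7 m 5 R.
Proof.
exists 7, (cyclic_ranks 7 [:: 3; 2; 5; 6; 4; 1] [:: 6; 5; 2; 1; 4; 3]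
  [:: (1, [:: 0; 7; 20; 23; 38; 39; 55; 71; 84; 87; 102; 103; 119; 127]);
      (2, [:: 3; 11; 35; 43]);
      (3, [:: 2; 34])]).
by apply: realizingP; vm_compute.
Qed.

Lemma realizing_add n1 n2 k1 k2 :
  (exists m R, realizing n1 m k1 R) -> (exists m R, realizing n2 m k2 R) ->
  exists m R, realizing (n1 + n2) m (k1 + k2) R.
Proof.
case=> m1 [R1 H1] [m2 [R2 H2]]; exists (m1 + m2), (product_ranks n1 R1 R2).
exact: realizing_product.
Qed.

(** * The bound *)

(** [(5 * n + 6) %/ 7] is the ceiling of [5 * n / 7]; it grows by 5 when [n] grows
    by 7, and the base cases are sums of 1, 4 and 7. *)
Lemma realizing_boolean n : 0 < n ->
  exists m R, realizing n m ((5 * n + 6) %/ 7) R.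
Proof.
elim/ltn_ind: n => n IH n_gt0; have [lt7n|] := ltnP 7 n.
  have -> : (5 * n + 6) %/ 7 = 5 + (5 * (n - 7) + 6) %/ 7 by lia.
  rewrite -{1}(subnKC (ltnW lt7n)); apply: (realizing_add realizing_7).
  by apply: IH; lia.
have r2 := realizing_add realizing_1 realizing_1.
move Ek: (_ %/ 7) => k.
case: n {IH} n_gt0 Ek => [|[|[|[|[|[|[|[|n]]]]]]]] // _ Ek _.
- have -> : k = 1 by lia.
  exact: realizing_1.
- have -> : k = 1 + 1 by lia.
  exact: r2.
- have -> : k = 1 + (1 + 1) by lia.
  exact: (realizing_add realizing_1 r2).
- have -> : k = 3 by lia.
  exact: realizing_4.
- have -> : k = 1 + 3 by lia.
  exact: (realizing_add realizing_1 realizing_4).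
- have -> : k = 1 + 1 + 3 by lia.
  exact: (realizing_add r2 realizing_4).
- have -> : k = 5 by lia.
  exact: realizing_7.
Qed.

Local Open Scope ring_scope.

Theorem mainTheorem7 (n : nat) (n_gt0 : (0 < n)%N) :
  (ldim (booleanLattice n))%:Z <= Num.ceil (5 / 7 * n%:R : rat).
Proof.
have [m [R /ldim_ranks le]] := realizing_boolean n_gt0.
have := ceil_ge (5 / 7 * n%:R : rat); move: (Num.ceil _) => c le_c.
have : (5 * n)%:Z <= 7 * c.
  rewrite -(ler_int rat) intrM -pmulrn natrM.
  by lra.
by move: (ldim _) le => l; lia.
Qed.
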